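(* Let $p>1$, $\lambda_1\ge0$ and $\lambda_2\ge1$ be integers with $\lambda_1\neq\lambda_2$. Let $a_1,\dots,a_p$ be positive integers with $a_1\le\dots\le a_p$ and $a_p\ge2$, and let $G=K(a_1,\dots,a_p;\lambda_1,\lambda_2)$. Then $G$ is Hamiltonian decomposable if and only if: (i) $a_1=a_2=\dots=a_p=:a$; (ii) $\lambda_1(a-1)+\lambda_2a(p-1)$ is an even integer; and (iii) $\lambda_1\le\lambda_2a(p-1)$.
   Context: $K(a_1,\dots,a_p;\lambda_1,\lambda_2)$ is the multigraph (no loops) whose vertex set is partitioned into $p$ parts $V_1,\dots,V_p$ with $|V_i|=a_i$, in which every pair of distinct vertices in the same part is joined by exactly $\lambda_1$ edges and every pair of vertices in different parts is joined by exactly $\lambda_2$ edges. A Hamiltonian decomposition of a graph is a partition of its edge set into sets each of which induces a spanning cycle (Hamiltonian cycle); a graph is Hamiltonian decomposable if it has one. *)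

(* Defs.v *)
From mathcomp Require Import all_boot.

Set Implicit Arguments.
Unset Strict Implicit.
Unset Printing Implicit Defensive.

(* Parallel edges are distinct elements of [edge] with the same [ends];
   there are no loops. *)
Record multigraph := Multigraph {
  vertex : finType;
  edge : finType;
  ends : edge -> {set vertex};
  card_ends : forall e, #|ends e| = 2 }.

(* [ordS] is the cyclic successor on 'I_n, so the cycle visits
   v 0, ..., v (n - 1), v 0; the bijectivity of [v] says that it is spanning.
   For n = 2 the cycle consists of two parallel edges. *)
Definition hamiltonian_cycle (G : multigraph) (C : {set edge G}) : Prop :=
  exists n (v : 'I_n -> vertex G) (e : 'I_n -> edge G),
    [/\ 1 < n, bijective v, injective e, C = [set e i | i : 'I_n]
      & forall i, ends (e i) = [set v i; v (ordS i)]].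

Definition hamiltonian_decomposable (G : multigraph) : Prop :=
  exists P : {set {set edge G}},
    partition P [set: edge G] /\ forall C, C \in P -> hamiltonian_cycle C.

Section MultipartiteMultigraph.

Variables (p : nat) (a : 'I_p -> nat) (l1 l2 : nat).

(* The part containing the vertex [u] is [tag u]. *)
Definition Kvertex : finType := {i : 'I_p & 'I_(a i)}.

Definition Kmult (s : {set Kvertex}) : nat :=
  if [forall u in s, forall v in s, tag u == tag v] then l1 else l2.

(* An edge is an unordered pair of distinct vertices together with the rank
   of the edge among those joining this pair. *)
Definition Kedge : finType :=
  {s : {s : {set Kvertex} | #|s| == 2} & 'I_(Kmult (val s))}.

Definition Kends (e : Kedge) : {set Kvertex} := val (tag e).

Lemma card_Kends (e : Kedge) : #|Kends e| = 2.
Proof. exact: eqP (valP (tag e)). Qed.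

Definition K : multigraph := Multigraph card_Kends.

End MultipartiteMultigraph.

(* Main.v *)
Require Import Defs.
From mathcomp Require Import all_boot zify.

(** Necessity: every vertex lies on two edges of each Hamiltonian cycle, so the
    graph is regular of even degree; and a Hamiltonian cycle has at most
    [a - 1] edges inside a part, which bounds the number of such edges.

    Sufficiency is by amalgamation and detachment.  Each part is shrunk to one
    vertex, giving [p] vertices with loops; a colour class of this graph is
    represented by an Eulerian circuit, i.e. a closed word visiting each vertex
    [a] times.  A vertex visited [k] times by each circuit can be split into
    two, visited [k - 1] times and once, by moving two ends of edges of each
    colour: the circuits stay closed as long as these two ends belong to
    different excursions from the vertex, and Hall's theorem allows them to be
    chosen so that every edge multiplicity is shared out proportionally.
    Splitting until each vertex is visited once yields Hamiltonian cycles.  The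
    colouring one starts from is obtained in the same way: shrinking everything
    to a single vertex first shows that [l2 * a ^ 2] copies of the complete
    graph on [p] vertices decompose into Hamiltonian cycles; between one and
    [a] of these, together with loops, make up each colour class. *)

Set Implicit Arguments.
Unset Strict Implicit.
Unset Printing Implicit Defensive.

(** * Hall's theorem and the choice of edge ends *)

Section Hall.

Variables (X Y : finType).
Implicit Types (r : X -> Y -> bool) (A S : {set X}).

Definition nbrs r S : {set Y} := [set y | [exists x in S, r x y]].

(** Induction on [#|A|]. A tight nonempty proper subset is matched first and the rest is matched
    outside its neighbours; if there is none, any single pair may be fixed, since every smaller set
    can spare a neighbour. *)
Lemma hall_on (y0 : Y) A r :
    (forall S, S \subset A -> #|S| <= #|nbrs r S|) ->
  exists2 f : X -> Y, {in A &, injective f} & {in A, forall x, r x (f x)}.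
Proof.
have [n] := ubnP #|A|; elim: n => // n IHn in A r *; rewrite ltnS => leAn hallA.
have [-> | [x xA]] := set_0Vmem A.
  by exists (fun=> y0) => x; rewrite inE.
have [/existsP[S /and3P[S_neq0 ltSA /eqP tightS]] | slack] :=
    boolP [exists S : {set X}, [&& S != set0, S \proper A & #|nbrs r S| == #|S|]].
  have ltcSA := proper_card ltSA; have sSA := proper_sub ltSA.
  have [||f injf rf] := IHn S r; first exact: leq_trans leAn.
    by move=> S' sS'S; apply/hallA/(subset_trans sS'S).
  pose r' x y := r x y && (y \notin nbrs r S).
  have [||g injg rg] := IHn (A :\: S) r'.
  - rewrite cardsD (setIidPr sSA).
    by move: S_neq0; rewrite -card_gt0; lia.
  - move=> S' sS'.
    have disj : [disjoint S' & S].
      by rewrite -setI_eq0 -subset0; apply/subsetP => z /setIP[/(subsetP sS')];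
         rewrite !inE => /andP[/negPf->].
    (* Hall's condition for [S' :|: S], minus the equality for the tight set [S], is the condition
       for [S'] under [r']. *)
    have := hallA (S' :|: S).
    have sS'A : S' \subset A by apply: subset_trans sS' (subsetDl _ _).
    rewrite subUset sS'A sSA => /(_ isT).
    have -> : nbrs r (S' :|: S) = nbrs r' S' :|: nbrs r S.
      apply/setP=> y; rewrite !inE; apply/existsP/orP.
        case=> z /andP[]; rewrite inE => zSS rzy.
        have [yS | yNS] := boolP (y \in nbrs r S); first by right; rewrite inE in yS.
        left; apply/existsP; exists z; rewrite /r' rzy yNS !andbT.
        case/orP: zSS => // zS; case/negP: yNS; rewrite inE.
        by apply/existsP; exists z; rewrite zS.
      case=> /existsP[z /andP[zS]].
        by case/andP=> rzy _; exists z; rewrite inE zS.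
      by move=> rzy; exists z; rewrite inE zS orbT.
    rewrite !cardsU tightS.
    have /eqP-> : S' :&: S == set0 by rewrite setI_eq0.
    by rewrite cards0; lia.
  exists (fun z => if z \in S then f z else g z).
    have sep z z' : z \in S -> z' \in A :\: S -> f z <> g z'.
      move=> zS /rg /andP[_ /negP ngz'] eqfg; apply: ngz'; rewrite -eqfg inE.
      by apply/existsP; exists z; rewrite zS rf.
    move=> z z' zA z'A /=.
    case: ifP => zS; case: ifP => z'S.
    - exact: injf.
    - by move/sep=> eqN; case: eqN; rewrite // !inE z'S.
    - by move/esym/sep=> eqN; case: eqN; rewrite // !inE zS.
    - by apply: injg; rewrite inE ?zS ?z'S.
  move=> z zA /=; case: ifP => zS; first exact: rf.
  by have /rg/andP[] : z \in A :\: S by rewrite inE zS.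
have /card_gt0P[y] : 0 < #|nbrs r [set x]|.
  by have := hallA [set x]; rewrite cards1 sub1set; apply.
rewrite inE => /existsP[_ /andP[/set1P-> rxy]].
pose r' x y' := r x y' && (y' != y).
have [||g injg rg] := IHn (A :\ x) r'.
- by move: leAn; rewrite (cardsD1 x A) xA.
- move=> S sS; have [-> | S_neq0] := eqVneq S set0; first by rewrite cards0.
  have := hallA S (subset_trans sS (subD1set _ _)).
  have ltSA : S \proper A by apply: sub_proper_trans sS (properD1 xA).
  move: slack; rewrite negb_exists => /forallP/(_ S).
  rewrite S_neq0 ltSA /= => neqNS leSN.
  have ltSN : #|S| < #|nbrs r S| by rewrite ltn_neqAle eq_sym neqNS.
  have : nbrs r S :\ y \subset nbrs r' S.
    apply/subsetP=> y'; rewrite !inE => /andP[ny /existsP[z /andP[zS rz]]].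
    by apply/existsP; exists z; rewrite zS /r' rz.
  by move/subset_leq_card; move: ltSN; rewrite (cardsD1 y (nbrs r S)); lia.
exists (fun z => if z == x then y else g z).
  have gNy z : z \in A -> z != x -> g z != y.
    by move=> zA zNx; have /rg/andP[] : z \in A :\ x by rewrite !inE zNx.
  move=> z z' zA z'A /=.
  case: eqVneq => [-> | zNx]; case: eqVneq => [-> | z'Nx] //.
  - by move/esym/eqP; rewrite (negPf (gNy _ _ _)).
  - by move/eqP; rewrite (negPf (gNy _ _ _)).
  - by apply: injg; rewrite !inE ?zNx ?z'Nx.
move=> z zA /=; case: eqVneq => [-> // | zNx].
by have /rg/andP[] : z \in A :\ x by rewrite !inE zNx.
Qed.

Lemma hall r :
    (forall S, #|S| <= #|nbrs r S|) ->
  exists2 f : X -> Y, injective f & forall x, r x (f x).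
Proof.
move=> hallX; have [x0 _ | noX] := pickP X; last first.
  have noX' : X -> False by move=> x; have := noX x.
  by exists (fun x => False_rect Y (noX' x)) => x; have := noX' x.
have /card_gt0P[y0 _] : 0 < #|nbrs r [set x0]|.
  by apply: leq_trans (hallX _); rewrite cards1.
have [//|f injf rf] := hall_on y0 (A := [set: X]) (r := r).
by exists f => [x x' /injf|x]; [apply; rewrite inE | apply: rf].
Qed.

End Hall.

Section Selection.

Variables (J V : finType) (k : nat).

(** Serves in [selection] to count all slots, the neighbours of a set of pairs, and the slots of a
    single label. *)
Lemma card_slots (b : V -> nat) (c : nat) (P : pred V) (Q : pred J) :
  #|[set y : {w : V & 'I_(b w)} + J * 'I_c |
      match y with inl s => P (tag s) | inr q => Q q.1 end]| =
  \sum_(w | P w) b w + #|Q| * c.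
Proof.
rewrite -sum1_card (eq_bigl _ _ (in_set _)) big_sumType /=; congr (_ + _).
  under eq_bigl => s do rewrite -[P _]andbT.
  rewrite -(sig_big_dep P (fun=> xpredT) (fun _ _ => 1)) /=.
  by apply: eq_bigr => w _; rewrite sum1_card card_ord.
under eq_bigl => q do rewrite -[Q _]andbT.
rewrite -(pair_big Q xpredT (fun _ _ => 1)) -sum_nat_const /=.
by apply: eq_bigr => j _; rewrite sum1_card card_ord.
Qed.

(* Each pair [(j, i)] is matched either to one of the [b w] slots of one of its
   two labels [w], or to one of the [k - 2] dummy slots of the colour [j];
   giving each label of each pair the weight [1 / k] spread over its slots and
   each dummy slot the weight [1 / k] is a fractional perfect matching. *)
Lemma selection (pr : J -> 'I_k -> bool -> V) (b : V -> nat) :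
    1 < k ->
    (forall w, \sum_j \sum_i \sum_c (pr j i c == w) = k * b w) ->
  exists sel : J -> bool -> 'I_k * bool,
    (forall j, (sel j true).1 != (sel j false).1) /\
    forall w, \sum_j \sum_e (pr j (sel j e).1 (sel j e).2 == w) = b w.
Proof.
move=> k_gt1 prb.
pose X : finType := (J * 'I_k)%type.
pose Y : finType := ({w : V & 'I_(b w)} + J * 'I_(k - 2))%type.
pose r (x : X) (y : Y) := match y with
  | inl s => [exists c, pr x.1 x.2 c == tag s]
  | inr q => x.1 == q.1 end.
have sumb (W : pred V) :
    k * \sum_(w | W w) b w = \sum_(x : X) \sum_c W (pr x.1 x.2 c).
  rewrite big_distrr /= -(eq_bigr _ (fun w _ => prb w)).
  under eq_bigr => w _ do rewrite pair_big.
  rewrite exchange_big; apply: eq_bigr => x _; rewrite exchange_big /=.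
  apply: eq_bigr => c _; have [Wx | NWx] := boolP (W _).
    rewrite (bigD1 (pr x.1 x.2 c)) //= eqxx big1 // => w /andP[_].
    by rewrite eq_sym => /negPf->.
  by apply: big1 => w Ww; case: eqP => // eq_w; rewrite eq_w Ww in NWx.
have sumbT : \sum_w b w = 2 * #|J|.
  apply/eqP; rewrite -(eqn_pmul2l (ltnW k_gt1)) sumb.
  under eq_bigr => x _ do rewrite big_bool.
  rewrite sum_nat_const card_prod card_ord.
  by change (#|J| * k * 2 == k * (2 * #|J|)); rewrite -mulnA mulnCA [#|J| * 2]mulnC.
have cardXY : #|{: X}| = #|{: Y}|.
  transitivity (2 * #|J| + #|J| * (k - 2)).
    by rewrite card_prod card_ord [2 * _]mulnC -mulnDr subnKC.
  rewrite -sumbT -(card_slots b (k - 2) xpredT xpredT) -[RHS]cardsT.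
  by apply: eq_card => [[s|q]]; rewrite !inE.
have [S|f injf rf] := @hall X Y r.
  pose W w := [exists x in S, exists c, pr x.1 x.2 c == w].
  pose JS j := [exists x in S, x.1 == j].
  have -> : nbrs r S = [set y : Y | match y with inl s => W (tag s) | inr q => JS q.1 end].
    by apply/setP=> [[s|q]]; rewrite !inE.
  (* Hall's condition is multiplied by [k = 2 + (k - 2)]: the labels of [S] account for [2 * #|S|],
     and [S] meets at least [#|S| / k] colours, each with [k - 2] dummy slots. *)
  rewrite card_slots -(leq_pmul2l (ltnW k_gt1)) mulnDr sumb mulnA.
  have leW : 2 * #|S| <= \sum_(x : X) \sum_c W (pr x.1 x.2 c).
    rewrite mulnC -sum_nat_const [leqRHS](bigID (mem S)) /=.
    apply: leq_trans (leq_addr _ _); apply: leq_sum => x xS.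
    have Wx c : W (pr x.1 x.2 c).
      by apply/existsP; exists x; rewrite xS; apply/existsP; exists c.
    by rewrite big_bool !Wx.
  have leJ : #|S| <= k * #|JS|.
    rewrite mulnC -[k in leqRHS]card_ord -cardsT -[#|JS|]cardsE -cardsX.
    apply/subset_leq_card/subsetP => x xS; rewrite !inE andbT.
    by apply/existsP; exists x; rewrite xS /=.
  apply: leq_trans (leq_add leW (leq_mul leJ (leqnn (k - 2)))).
  by rewrite mulnC [2 * _]mulnC -mulnDr subnKC.
have bijf : bijective f by apply: inj_card_bij => //; rewrite cardXY.
pose real (y : Y) := if y is inl _ then true else false.
have card_real j : #|[set i | real (f (j, i))]| = 2.
  have -> : [set i | real (f (j, i))] = ~: [set i | ~~ real (f (j, i))].
    by apply/setP=> i; rewrite !inE negbK.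
  rewrite cardsCs setCK card_ord.
  (* A perfect matching fills all [k - 2] dummy slots of [j], and only pairs of colour [j] can fill
     them; the two remaining pairs of colour [j] are the selected ones. *)
  suff -> : #|[set i | ~~ real (f (j, i))]| = k - 2 by rewrite subKn.
  have injj : injective (fun i => f (j, i)) by move=> i i' /injf[].
  rewrite -(card_imset _ injj) -[RHS]card_ord.
  have injr : injective (fun q : 'I_(k - 2) => inr (j, q) : Y) by move=> q q' [].
  rewrite -[RHS](card_imset _ injr); apply: eq_card => y.
  apply/imsetP/imsetP=> [[i] | [q _ ->]].
    have := rf (j, i); rewrite inE; case: (f _) => // [[j' q]] /= /eqP <- _ ->.
    by exists q.
  have [f' _ /(_ (inr (j, q)))] := bijf; case: (f' _) => j' i fji.
  have := rf (j', i); rewrite fji => /eqP /= def_j'; rewrite def_j' in fji.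
  by exists i; rewrite ?inE fji.
have sel_ex j : exists s : bool -> 'I_k * bool,
    (s true).1 != (s false).1 /\
    forall w, \sum_e (pr j (s e).1 (s e).2 == w) =
      #|[set i | if f (j, i) is inl s then tag s == w else false]|.
  have /eqP/cards2P[i1 [i2 [i1Ni2 def_real]]] := card_real j.
  have lab i : i \in [set i1; i2] ->
      exists c, if f (j, i) is inl s then pr j i c = tag s else False.
    rewrite -def_real inE; have := rf (j, i); case: (f _) => // s /existsP[c /eqP].
    by exists c.
  have [c1 lab1] := lab i1 (set21 _ _); have [c2 lab2] := lab i2 (set22 _ _).
  exists (fun e => if e then (i1, c1) else (i2, c2)); split=> //= w.
  rewrite big_bool /=.
  transitivity (\sum_(i in [set i1; i2])
      (if f (j, i) is inl s then tag s == w else false)).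
    rewrite big_setU1 ?inE //= big_set1.
    by move: lab1 lab2; case: (f _) => // s1 ->; case: (f _) => // s2 ->.
  rewrite -def_real -sum1_card big_mkcond [RHS]big_mkcond; apply: eq_bigr => i _.
  by rewrite !inE; case: (f _) => //= s; case: eqP.
have [sel selP] := fin_all_exists sel_ex; exists sel; split=> [j | w].
  by case: (selP j).
(* The selected labels equal to [w] correspond to the slots of [w], each filled exactly once because
   [f] is bijective. *)
under eq_bigr => j _ do rewrite (proj2 (selP j)) -sum1_card.
rewrite pair_big_dep /=.
have := card_slots b (k - 2) (pred1 w) xpred0.
rewrite big_pred1_eq card0 addn0 => <-.
rewrite sum1dep_card -(card_imset _ injf); apply: eq_card => y.
apply/imsetP/idP=> [[[j i]] | ].
  by rewrite !inE; case: (f _) => // s /= ? ->.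
rewrite inE; have [f' _ f'K] := bijf => yw; exists (f' y); rewrite ?f'K //.
by rewrite !inE -surjective_pairing f'K; case: y yw.
Qed.
End Selection.

(** * Closed words *)

Section Words.

Variable V : eqType.
Implicit Types (u w x y z : V) (s t : seq V).

(** A sum instead of a disjunction, so that a loop counts twice. *)
Definition link u w x y : nat := ((x == u) && (y == w)) + ((x == w) && (y == u)).
Arguments link : simpl never.

Fixpoint walk u w x s : nat :=
  if s is y :: s' then link u w x y + walk u w y s' else 0.

(** The walk is closed by returning to its first letter; a one-letter word is therefore a loop. *)
Definition cyc u w t : nat := if t is x :: s then walk u w x (rcons s x) else 0.

Lemma linkC u w x y : link u w x y = link u w y x.
Proof. by rewrite /link [(x == u) && _]andbC [(x == w) && _]andbC addnC. Qed.

Lemma walk_cat u w x s1 s2 :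
  walk u w x (s1 ++ s2) = walk u w x s1 + walk u w (last x s1) s2.
Proof. by elim: s1 x => //= y s1 IHs x; rewrite IHs addnA. Qed.

Lemma walk_rcons u w x s y :
  walk u w x (rcons s y) = walk u w x s + link u w (last x s) y.
Proof. by rewrite -cats1 walk_cat /= addn0. Qed.

Lemma walk_rev u w x s y :
  walk u w x (rcons s y) = walk u w y (rcons (rev s) x).
Proof.
elim: s x => [|z s IHs] x /=; first by rewrite linkC.
by rewrite IHs rev_cons [RHS]walk_rcons addnC last_rcons linkC.
Qed.

Lemma cyc_rcons u w x s : cyc u w (rcons s x) = cyc u w (x :: s).
Proof.
case: s => //= y s; rewrite -[rcons (rcons _ _) _]cats1 walk_cat /= addn0.
by rewrite last_rcons addnC.
Qed.

Lemma cyc_rot u w n t : cyc u w (rot n t) = cyc u w t.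
Proof.
elim: n => [|n IHn]; first by rewrite rot0.
have [le_t_n | lt_n_t] := leqP (size t) n.
  by rewrite rot_oversize // ltnW.
by rewrite rotS // -{}IHn; case: (rot n t) => //= x s; rewrite rot1_cons cyc_rcons.
Qed.

Lemma cyc_cons_cat u w x s1 s2 :
  cyc u w (x :: s1 ++ x :: s2) = cyc u w (x :: s1) + cyc u w (x :: s2).
Proof. by rewrite /= rcons_cat -cat_rcons walk_cat last_rcons. Qed.

(** Both words are rotated to begin with the common letter [x] and then concatenated. *)
Lemma merge_words t1 t2 x : x \in t1 -> x \in t2 ->
  exists t, (forall y, count_mem y t = count_mem y t1 + count_mem y t2) /\
            (forall u w, cyc u w t = cyc u w t1 + cyc u w t2).
Proof.
move=> /rot_to[n1 s1 def1] /rot_to[n2 s2 def2].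
exists ((x :: s1) ++ x :: s2); split=> [y | u w].
  by rewrite count_cat -def1 -def2; congr (_ + _); apply/permP; rewrite perm_rot.
by rewrite cyc_cons_cat -def1 -def2 !cyc_rot.
Qed.

Lemma merge_all t0 (ws : seq (seq V)) :
    (forall t, t \in ws -> exists2 x, x \in t & x \in t0) ->
  exists t, (forall y, count_mem y t = count_mem y t0 + \sum_(s <- ws) count_mem y s) /\
            (forall u w, cyc u w t = cyc u w t0 + \sum_(s <- ws) cyc u w s).
Proof.
elim: ws => [|s ws IHws] meet.
  by exists t0; split=> *; rewrite big_nil addn0.
have [t' ws't'|t [cnt_t cyc_t]] := IHws.
  by apply: meet; rewrite inE ws't' orbT.
have [|x xs xt0] := meet s; first by rewrite mem_head.
have xt : x \in t by move: xt0; rewrite -!has_pred1 !has_count cnt_t; lia.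
have [t' [cnt_t' cyc_t']] := merge_words xt xs.
by exists t'; split=> *; rewrite ?cnt_t' ?cyc_t' ?cnt_t ?cyc_t big_cons; lia.
Qed.

Lemma walk_avoiding u w x s y : u \notin x :: s ->
  walk u w x (rcons s y) = (last x s == w) && (y == u).
Proof.
elim: s x => [|z s IHs] x; rewrite in_cons negb_or eq_sym => /andP[/negPf uNx uNs] /=.
  by rewrite /link uNx addn0.
rewrite IHs //; move: uNs; rewrite in_cons negb_or eq_sym => /andP[/negPf uNz _].
by rewrite /link uNx uNz andbF.
Qed.

(** Only the first and the last step touch [v]. The default [v] of [head] and [last] covers the
    empty segment, a loop at [v]. *)
Lemma walk_segment v w s : v \notin s ->
  walk v w v (rcons s v) = (head v s == w) + (last v s == w).
Proof.
case: s => [|x s] vNs /=; first by rewrite /link eqxx andbT addn0.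
rewrite walk_avoiding // eqxx andbT; congr (_ + _).
move: vNs; rewrite in_cons negb_or eq_sym => /andP[/negPf vNx _].
by rewrite /link eqxx vNx andbF addn0.
Qed.

Lemma cyc_segments u w v s ss :
  cyc u w (v :: s ++ flatten (map (cons v) ss)) =
    \sum_(s' <- s :: ss) walk u w v (rcons s' v).
Proof.
elim: ss s => [|s' ss IHss] s; first by rewrite cats0 big_seq1.
by rewrite [flatten _]/= cyc_cons_cat IHss [RHS]big_cons.
Qed.

Lemma flatten_segments v s : exists ss,
  all (fun s' => v \notin s') ss /\ v :: s = flatten (map (cons v) ss).
Proof.
elim: s => [|x s [ss [vNss def_s]]]; first by exists [:: [::]].
case: ss vNss def_s => [|s1 ss] //= /andP[vNs1 vNss] [def_s].
have [-> | xNv] := eqVneq x v.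
  by exists [:: [::], s1 & ss]; rewrite /= vNs1 vNss def_s.
by exists ((x :: s1) :: ss); rewrite /= inE negb_or eq_sym xNv vNs1 vNss def_s.
Qed.

(** The word, rotated to begin with [v], is cut before each occurrence of [v]. *)
Lemma segments v t : v \in t ->
  exists ss : seq (seq V), [/\ size ss = count_mem v t,
    all (fun s => v \notin s) ss,
    forall y, count_mem y t = \sum_(s <- ss) count_mem y (v :: s)
    & forall u w, cyc u w t = \sum_(s <- ss) walk u w v (rcons s v)].
Proof.
case/rot_to=> n s def_t; have [ss [vNss def_s]] := flatten_segments v s.
have cnt y : count_mem y t = \sum_(s <- ss) count_mem y (v :: s).
  have /permP <- : perm_eq (rot n t) t by rewrite perm_rot.
  by rewrite def_t def_s count_flatten sumnE !big_map.
exists ss; split=> // [|u w].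
  rewrite cnt -sum1_size [LHS]big_seq [RHS]big_seq; apply: eq_bigr => s' /(allP vNss).
  by rewrite /= eqxx => /count_memPn->.
rewrite -(cyc_rot _ _ n) def_t def_s.
by case: ss {vNss def_s cnt} => [|s1 ss]; rewrite ?big_nil ?cyc_segments.
Qed.

Lemma perm_nth2 (T : eqType) (x0 : T) (s : seq T) i j :
    i < size s -> j < size s -> i != j ->
  exists s0 : seq T, perm_eq s (nth x0 s i :: nth x0 s j :: s0).
Proof.
move=> lt_i lt_j iNj; exists (map (nth x0 s) (rem j (rem i (iota 0 (size s))))).
rewrite -{1}(mkseq_nth x0 s) -!map_cons; apply: perm_map.
have ri : i \in iota 0 (size s) by rewrite mem_iota.
apply: perm_trans (perm_to_rem ri) _; rewrite perm_cons; apply: perm_to_rem.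
by rewrite mem_rem_uniq ?iota_uniq // !inE eq_sym iNj mem_iota.
Qed.

(* The word consists of [k] segments leading from [v] back to [v]; the two ends
   of the [i]-th one are the letters [pr i true] and [pr i false].  Moving one
   end of each of two distinct segments from [v] to [z] leaves a closed word:
   follow the first segment from [v] to [z] and then the second from [z] to
   [v]. *)
Lemma split_word v z t k : count_mem v t = k -> 0 < k ->
  exists pr : 'I_k -> bool -> V,
    (forall w, \sum_i \sum_c (pr i c == w) = cyc v w t) /\
    forall i i' c c', i != i' -> exists t',
      (forall x, count_mem x t' + (v == x) = count_mem x t + (z == x)) /\
      forall u w,
        cyc u w t' + link u w (pr i c) v + link u w (pr i' c') v =
        cyc u w t + link u w (pr i c) z + link u w (pr i' c') z.
Proof.
move=> cnt_v k_gt0; have vt : v \in t by rewrite -has_pred1 has_count cnt_v.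
have [ss [sz_ss vNss cntE cycE]] := segments vt; rewrite cnt_v in sz_ss.
(* Orientation puts the end labelled [c] last, so the step to be moved is always the final one. *)
pose orient (c : bool) s : seq V := if c then s else rev s.
have walk_orient c s u w : walk u w v (rcons (orient c s) v) = walk u w v (rcons s v).
  by case: c => //=; rewrite -walk_rev.
have cnt_orient c s y : count_mem y (orient c s) = count_mem y s.
  by case: c => //=; rewrite count_rev.
exists (fun i c => last v (orient c (nth [::] ss i))); split.
  move=> w; rewrite cycE (big_nth [::]) sz_ss big_mkord; apply: eq_bigr => i _.
  rewrite big_bool walk_segment; last first.
    by apply: (allP vNss); rewrite mem_nth ?sz_ss.
  rewrite addnC; congr ((_ == w) + _); rewrite /orient.
  by case: (nth _ _ _) => //= x s; rewrite rev_cons last_rcons.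
move=> i i' c c' iNi'.
have [||rest perm_ss] := @perm_nth2 _ [::] ss i i' _ _ iNi'; rewrite ?sz_ss //.
set s1 := nth _ _ i in perm_ss *; set s2 := nth _ _ i' in perm_ss *.
(* The [v] between the two chosen segments is replaced by [z], and the second segment is reversed so
   that its moved end follows [z]. *)
exists (v :: (orient c s1 ++ z :: rev (orient c' s2)) ++ flatten (map (cons v) rest)).
split=> [x|u w].
  rewrite cntE (perm_big _ perm_ss) !big_cons /= !count_cat /= count_rev.
  rewrite !cnt_orient count_flatten sumnE !big_map.
  rewrite -[X in _ + (_ + X) + _]/(\sum_(s <- rest) ((v == x) + count_mem x s)).
  move: (count_mem x s1) (count_mem x s2) (\sum_(s <- rest) _) => n1 n2 n3.
  move: (nat_of_bool (v == x)) (nat_of_bool (z == x)) => n4 n5.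
  by lia.
rewrite cyc_segments cycE (perm_big _ perm_ss) !big_cons /=.
rewrite -(walk_orient c s1) -(walk_orient c' s2).
rewrite rcons_cat walk_cat /= -walk_rev !walk_rcons; lia.
Qed.

End Words.

(** * Detachments *)

Section Detachment.

Variables (V : finType) (I : eqType) (part : V -> I) (L : V -> V -> nat).
Hypothesis LC : forall u w, L u w = L w u.
Hypothesis L_part : forall u v w, part u = part v -> L u w = L v w.

(* The words [t j] are Eulerian circuits of the colour classes of a multigraph
   with [L u w * g u * g w] edges between [u] and [w] and [L u u * 'C(g u, 2)]
   loops at [u] (loops count twice in [cyc]), each class being regular of
   degree [2 * g u] at [u]. *)
Definition balanced (J : finType) (g : V -> nat) (t : J -> seq V) : Prop :=
  (forall j u, count_mem u (t j) = g u) /\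
  forall u w, \sum_j cyc u w (t j) = L u w * (g u * (g w - (u == w))).

Lemma split_vertex (J : finType) g (t : J -> seq V) v z :
    part z = part v -> 1 < g v -> g z = 0 -> balanced g t ->
  exists t' : J -> seq V,
    balanced (fun x => if x == v then (g v).-1 else if x == z then 1 else g x) t'.
Proof.
move=> vz gv_gt1 gz0 [cnt_t cyc_t].
have [pr prP] := fin_all_exists (fun j => split_word z (cnt_t j v) (ltnW gv_gt1)).
(* One [g v]-th of the edge ends at [v] leading to [w]: the share due to [z], which will have weight
   one. *)
pose b w := L v w * (g w - (v == w)).
have [w|sel [selNeq selE]] := selection (pr := pr) (b := b) gv_gt1.
  under eq_bigr => j _ do rewrite (proj1 (prP j)).
  by rewrite cyc_t mulnCA.
have [t' t'P] := fin_all_exists (fun j =>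
  (prP j).2 _ _ (sel j true).2 (sel j false).2 (selNeq j)).
have zNv : z != v by apply: contraTneq gv_gt1 => <-; rewrite gz0.
exists t'; split=> [j u | u w].
  have := (t'P j).1 u; rewrite cnt_t.
  case: (eqVneq u v) => [->|uNv].
    by rewrite (negPf zNv); lia.
  by case: (eqVneq u z) => [->|_]; rewrite ?gz0; lia.
(* [S v] counts the [u]-[w] adjacencies of the moved edges before the move, [S z] those after it. *)
pose S y := \sum_j \sum_e link u w (pr j (sel j e).1 (sel j e).2) y.
have SE y : S y = b u * (y == w) + b w * (y == u).
  rewrite /S -!selE !big_distrl -big_split; apply: eq_bigr => j _.
  by rewrite !big_distrl -big_split; apply: eq_bigr => e _; rewrite /link /= !mulnb.
have : \sum_j cyc u w (t' j) + S v = \sum_j cyc u w (t j) + S z.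
  rewrite /S -!big_split; apply: eq_bigr => j _; rewrite !big_bool /=.
  by have := (t'P j).2 u w; lia.
have Lz x : L z x = L v x by apply: L_part.
have LCz x : L x z = L v x by rewrite LC Lz.
rewrite cyc_t !SE /b.
have vz' : (v == z) = false by rewrite eq_sym (negPf zNv).
(* This removes the truncated subtractions before the case analysis on [u] and [w] being [v], [z] or
   another vertex. *)
have [n gvE] : exists n, g v = n.+2 by exists (g v - 2); lia.
have uCv : L u v = L v u by apply: LC.
case: (eqVneq u v) uCv => [->|uNv] uCv; [|case: (eqVneq u z) uCv => [->|uNz] uCv];
case: (eqVneq w v) => [->|wNv]; try (case: (eqVneq w z) => [->|wNz]);
rewrite ?eqxx ?vz' ?(negPf zNv) ?gz0 ?gvE ?Lz ?LCz ?[v == _]eq_sym ?[z == _]eq_sym ?uCv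
  ?(negPf uNv) ?(negPf uNz) ?(negPf wNv) ?(negPf wNz) /=
  ?muln0 ?muln1 ?addn0 ?add0n ?mul0n ?subn0 ?mul1n ?subSS ?subn0; nia.
Qed.

Lemma sum_pred1 (P : pred V) x : \sum_(y | P y) (y == x) = P x.
Proof.
have [Px | NPx] := boolP (P x).
  by rewrite (bigD1 x) //= eqxx big1 // => y /andP[_ /negPf->].
by rewrite big1 // => y Py; case: eqP => // eq_yx; rewrite -eq_yx Py in NPx.
Qed.

(** Induction on the number of vertices of weight zero. The weights of a part sum to its size, so
    the part of such a vertex has one of weight above one, which can be split; without zeros all
    weights are one. *)
Lemma detach (J : finType) g (t : J -> seq V) :
    (forall i, \sum_(v | part v == i) g v = #|[pred v | part v == i]|) ->
    balanced g t ->
  exists t' : J -> seq V, balanced (fun=> 1) t'.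
Proof.
have [n] := ubnP #|[pred v | g v == 0]|.
elim: n => // n IHn in g t *; rewrite ltnS => le_n sum_g bal_t.
have [z /= gz0 | /= g_neq0] := pickP (fun v => g v == 0); last first.
  have g1 v : g v = 1.
    have : \sum_(u | part u == part v) (g u - 1) = 0.
      rewrite sumnB; last by move=> u _; rewrite lt0n g_neq0.
      by rewrite sum_g sum1_card subnn.
    move/eqP; rewrite sum_nat_eq0 => /forallP/(_ v)/implyP/(_ (eqxx _)).
    by have := g_neq0 v; case: (g v) => [|[]].
  by exists t; case: bal_t => cnt_t cyc_t; split=> *; rewrite ?cnt_t ?cyc_t !g1.
have [v /andP[/eqP vz gv_gt1] | /= noV] :=
    pickP (fun v => (part v == part z) && (1 < g v)); last first.
  have := sum_g (part z); rewrite -sum1_card (bigD1 z) // [in RHS](bigD1 z) ?inE //=.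
  rewrite (eqP gz0) => /eqP; rewrite eqn_leq => /andP[_].
  rewrite ltnNge leq_sum // => u /andP[uz _].
  by have := noV u; rewrite uz /=; lia.
have [t' bal_t'] := split_vertex (esym vz) gv_gt1 (eqP gz0) bal_t.
have zNv : z != v by apply: contraTneq gv_gt1 => <-; rewrite (eqP gz0).
apply: IHn bal_t'.
  apply: leq_trans le_n; apply: proper_card; apply/properP; split.
    apply/subsetP=> x; rewrite !inE; case: (eqVneq x v) => [->|_]; first by lia.
    by case: (eqVneq x z).
  by exists z; rewrite !inE // (negPf zNv) eqxx.
(* One unit of weight passes from [v] to [z], in the same part; an added term on both sides avoids
   subtraction. *)
move=> i; rewrite -sum_g; apply: (@addIn (part v == i)).
rewrite -[in LHS](sum_pred1 (fun x => part x == i) v) [in RHS]vz.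
rewrite -[in RHS](sum_pred1 (fun x => part x == i) z) -!big_split; apply: eq_bigr => x _ /=.
case: (eqVneq x v) => [->|_]; first by rewrite eq_sym (negPf zNv); lia.
by case: eqVneq => [->|_]; rewrite ?(eqP gz0); lia.
Qed.

End Detachment.

(** * Words for complete and multipartite multigraphs *)

Lemma cyc_nseq (V : eqType) (u w x : V) n : cyc u w (nseq n x) = n * link u w x x.
Proof.
case: n => //= n; elim: n => [|n IHn] /=; first by rewrite mul1n addn0.
by rewrite IHn mulSn.
Qed.

(** The two factors test whether [u] and [w] lie in the image of [h]. *)
Lemma cyc_map (V W : eqType) (h : W -> V) (h' : V -> W) (u w : V) (s : seq W) :
    cancel h h' ->
  cyc u w (map h s) = (h (h' u) == u) * (h (h' w) == w) * cyc (h' u) (h' w) s.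
Proof.
move=> hK; have hE x v : (h x == v) = (h (h' v) == v) && (x == h' v).
  by apply/eqP/andP=> [<- | [/eqP def_v /eqP->] //]; rewrite hK !eqxx.
have linkE x y : link u w (h x) (h y) =
    (h (h' u) == u) * (h (h' w) == w) * link (h' u) (h' w) x y.
  rewrite /link (hE x u) (hE y w) (hE x w) (hE y u).
  by case: (h (h' u) == u); case: (h (h' w) == w); rewrite /= ?andbF // !mul1n.
have walkE x s' : walk u w (h x) (map h s') =
    (h (h' u) == u) * (h (h' w) == w) * walk (h' u) (h' w) x s'.
  by elim: s' x => [|y s' IHs] x /=; rewrite ?muln0 // linkE IHs mulnDr.
by case: s => [|x s] /=; rewrite ?muln0 // -map_rcons walkE.
Qed.

Lemma link_loop (V : eqType) (u w x : V) :
  link u w x x = 2 * ((x == u) && (x == w)).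
Proof. by rewrite /link [(x == w) && _]andbC addnn mul2n. Qed.

(** All vertices are shrunk to [ord0]. Each word is [p] loops there, and the [N * p] loops are as
    many as the edges of [mu] copies of the complete graph. *)
Lemma complete_words p mu N : 0 < p -> mu * (p - 1) = 2 * N ->
  exists t : 'I_N -> seq 'I_p, balanced (fun _ _ => mu) (fun=> 1) t.
Proof.
case: p => // p _ muN; pose g (v : 'I_p.+1) := if v == ord0 then p.+1 else 0.
apply: (@detach _ _ (fun=> tt) (fun _ _ => mu) _ _ _ g (fun=> nseq p.+1 ord0)) => //.
  move=> []; rewrite (bigD1 ord0) //= big1 => [|i /negPf]; last by rewrite /g => ->.
  rewrite /g eqxx addn0 -[LHS]card_ord.
  by apply: eq_card => i; rewrite !inE; apply/esym/eqP.
split=> [j u | u w]; first by rewrite count_nseq /g /= eq_sym; case: (u == _); rewrite ?mul1n.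
under eq_bigr => j _ do rewrite cyc_nseq link_loop.
rewrite sum_nat_const card_ord /g !(eq_sym ord0).
have [->|uN0] := eqVneq u ord0; last by rewrite /= !(muln0, mul0n).
have [_|wN0] := eqVneq w ord0; first by move: muN; nia.
by rewrite /= !(muln0, sub0n).
Qed.

Section MultipartiteWords.

Variables (V : finType) (p m l1 l2 N : nat) (part : V -> 'I_p).
Hypothesis card_part : forall i, #|[pred v | part v == i]| = m.
Hypotheses (m_gt0 : 0 < m) (p_gt0 : 0 < p).
Hypothesis degE : l1 * (m - 1) + l2 * m * (p - 1) = 2 * N.
Hypothesis l1_le : l1 <= l2 * m * (p - 1).

(** Within a residue class an index is determined by its quotient by [N], which is less than [m]. *)
Lemma residue_class_le N1 (j : 'I_N) :
  N1 <= m * N -> \sum_(i : 'I_N1 | i %% N == j) 1 <= m.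
Proof.
move=> leN1; have N_gt0 : 0 < N by apply: leq_ltn_trans (ltn_ord j).
pose q (i : 'I_N1) := inord (i %/ N) : 'I_m.-1.+1.
have lt_q (i : 'I_N1) : i %/ N < m.-1.+1.
  by rewrite prednK // ltn_divLR // (leq_trans (ltn_ord i)).
have inj_q : {in [pred i : 'I_N1 | i %% N == j] &, injective q}.
  move=> i i'; rewrite !inE => /eqP Fi /eqP Fi' /(congr1 val).
  rewrite /= !inordK // => eq_q; apply: val_inj => /=.
  by rewrite (divn_eq i N) (divn_eq i' N) eq_q Fi Fi'.
rewrite sum1_card -(card_in_imset inj_q).
by apply: leq_trans (max_card _) _; rewrite card_ord prednK.
Qed.

(** Colour [j] merges the cycles whose index is [j] modulo [N]: at least the one with index [j], and
    at most [m]. Loops at every vertex bring the number of visits up to [m]. *)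
Lemma colour_word N1 (u : 'I_N1 -> seq 'I_p) (j : 'I_N) :
    N <= N1 -> N1 <= m * N -> (forall i x, count_mem x (u i) = 1) ->
  exists s : seq 'I_p, (forall x, count_mem x s = m) /\
    forall x y, cyc x y s = \sum_(i : 'I_N1 | i %% N == j) cyc x y (u i) +
      2 * (m - \sum_(i : 'I_N1 | i %% N == j) 1) * (x == y).
Proof.
move=> leN leN1 cnt_u.
pose F := [pred i : 'I_N1 | i %% N == j]; pose i0 := widen_ord leN j.
have Fi0 : F i0 by rewrite /= modn_small.
have N_gt0 : 0 < N by apply: leq_ltn_trans (ltn_ord j).
have leF : \sum_(i | F i) 1 <= m by apply: residue_class_le.
pose d := m - \sum_(i | F i) 1.
pose ws := map u (rem i0 (enum F)) ++ flatten (nseq d (map (fun x => [:: x]) (enum 'I_p))).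
have [t mem_t|t [cnt_t cyc_t]] := @merge_all _ (u i0) ws.
  have in_u i x : x \in u i by rewrite -has_pred1 has_count cnt_u.
  move: mem_t; rewrite mem_cat => /orP[/mapP[i _ ->] | /flattenP[s' /nseqP[-> _]]].
    by exists (Ordinal p_gt0).
  by case/mapP=> x _ ->; exists x; rewrite ?mem_head.
have sumws (f : seq 'I_p -> nat) : f (u i0) + \sum_(s <- ws) f s =
    \sum_(i | F i) f (u i) + d * \sum_x f [:: x].
  rewrite /ws big_cat /= big_map addnA; congr (_ + _).
    rewrite -[RHS](big_enum _ _ F (fun i => f (u i))) /=.
    have remF : perm_eq (enum F) (i0 :: rem i0 (enum F)).
      by apply: perm_to_rem; rewrite mem_enum.
    by rewrite (perm_big _ remF) big_cons.
  elim: (d) => [|n IHn] /=; first by rewrite big_nil.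
  by rewrite big_cat IHn big_map mulSn big_enum.
exists t; split=> [x | x y].
  rewrite cnt_t (sumws (count_mem x)).
  under eq_bigr => i _ do rewrite cnt_u.
  under [X in d * X]eq_bigr => y _ do rewrite /= addn0.
  by rewrite (sum_pred1 predT) muln1 subnKC.
rewrite cyc_t (sumws (cyc x y)); congr (_ + _).
have -> : \sum_z cyc x y [:: z] = 2 * (x == y).
  under eq_bigr => z _ do rewrite /= addn0 link_loop.
  rewrite -big_distrr; congr (2 * _).
  by rewrite (bigD1 x) //= eqxx big1 ?addn0 // => z /negPf->.
by rewrite mulnCA mulnA.
Qed.

Lemma multipartite_words : exists t : 'I_N -> seq V,
  balanced (fun u w => if part u == part w then l1 else l2) (fun=> 1) t.
Proof.
(* [N1] is the number of Hamiltonian cycles in [l2 * m ^ 2] copies of the complete graph on the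
   parts; the parity follows from [degE] times [m], as [m * (m - 1)] is even. *)
have [N1 N1E] : exists N1, l2 * m * m * (p - 1) = 2 * N1.
  exists (l2 * m * m * (p - 1))./2; rewrite mul2n even_halfK //.
  have : ~~ odd (m * (l1 * (m - 1) + l2 * m * (p - 1))).
    by rewrite degE mulnCA oddM.
  rewrite mulnDr oddD.
  have -> : odd (m * (l1 * (m - 1))) = false.
    by case: m m_gt0 => // n _; rewrite subn1 !oddM /=; case: (odd n); rewrite ?andbF.
  by congr (~~ odd _); rewrite !mulnA [m * l2]mulnC.
(* This is where condition (iii) enters; the next bound holds because [m * N - N1] is
   [l1 * 'C(m, 2)]. *)
have leN : N <= N1 by nia.
have leN1 : N1 <= m * N by nia.
have [u [cnt_u cyc_u]] := complete_words p_gt0 N1E.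
have [s sP] := fin_all_exists (fun j => colour_word j leN leN1 cnt_u).
have [rep repK] : exists rep : 'I_p -> V, cancel rep part.
  have /fin_all_exists[rep repP] i : exists v, part v = i.
    have : 0 < #|[pred v | part v == i]| by rewrite card_part.
    by case/card_gt0P=> v; rewrite inE => /eqP; exists v.
  by exists rep.
(* The shrunk part is represented by one of its own vertices, which carries the whole weight [m]. *)
pose g v := (rep (part v) == v) * m.
apply: (@detach _ _ part _ _ _ _ g (fun j => map rep (s j))).
- by move=> v w; rewrite eq_sym.
- by move=> v w z ->.
- move=> i; rewrite card_part (bigD1 (rep i)) /= ?repK // /g repK eqxx mul1n.
  rewrite big1 ?addn0 // => v /andP[/eqP <- ].
  by rewrite eq_sym => /negPf->.
split=> [j v | v w].
  rewrite count_map /g -(proj1 (sP j) (part v)); case: eqVneq => [def_v | Nrep].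
    rewrite mul1n; apply: eq_count => x /=.
    by rewrite -{1}def_v (can_eq repK).
  rewrite mul0n; apply/eqP; rewrite -leqn0 leqNgt -has_count; apply/hasPn => x _ /=.
  by apply: contraNneq Nrep => <-; rewrite repK.
under eq_bigr => j _ do rewrite (cyc_map _ _ _ repK) (proj2 (sP j)).
have sumF (f : 'I_N1 -> nat) :
    \sum_(j < N) \sum_(i : 'I_N1 | i %% N == j) f i = \sum_i f i.
  rewrite (exchange_big_dep predT) //=; apply: eq_bigr => i _.
  have N_gt0 : 0 < N.
    by move: leN1 (ltn_ord i); case: (posnP N) => // ->; rewrite muln0; lia.
  by rewrite (big_pred1 (Ordinal (ltn_pmod i N_gt0))) // => j; rewrite eq_sym.
rewrite -big_distrr big_split sumF cyc_u -big_distrl -big_distrr /=.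
(* The total number of loops added at each shrunk vertex. *)
have -> : \sum_(j < N) (m - \sum_(i : 'I_N1 | i %% N == j) 1) = m * N - N1.
  rewrite sumnB; last by move=> j _; apply: residue_class_le.
  by rewrite sumF !sum_nat_const !card_ord muln1 mulnC.
rewrite /g.
case: (eqVneq _ v) => [def_v|_]; last by rewrite !mul0n muln0.
case: (eqVneq _ w) => [def_w|_]; last by rewrite !(mul0n, sub0n, muln0).
have -> : (v == w) = (part v == part w) by rewrite -{1}def_v -{1}def_w (can_eq repK).
by case: eqP => _; nia.
Qed.

End MultipartiteWords.

(** * Hamiltonian decompositions *)

Lemma eq_set2 (T : finType) (u w x y : T) : u != w ->
  ([set x; y] == [set u; w]) = link u w x y :> nat.
Proof.
move=> /negPf uNw; rewrite eqEsubset !subUset !sub1set !inE /link.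
rewrite ![u == _]eq_sym ![w == _]eq_sym.
case: (eqVneq x u) => [->|_]; rewrite ?uNw /=.
  by rewrite addn0; case: (y == w); rewrite ?orbT ?andbF.
by case: (x == w); case: (y == u) (y == w) => [] [].
Qed.

Lemma walk_sum (V : eqType) (u w x : V) s :
  walk u w x s = \sum_(i < size s) link u w (nth x (x :: s) i) (nth x s i).
Proof.
elim: s x => [|y s IHs] x /=; first by rewrite big_ord0.
rewrite big_ord_recl /= IHs; congr (_ + _); apply: eq_bigr => i _.
by rewrite !(set_nth_default x y) //= ltnW // ltnS ltn_ord.
Qed.

(** Passes from words to the cyclic indexing by [ordS] used for Hamiltonian cycles. *)
Lemma cyc_sum (V : eqType) (u w x0 : V) t :
  cyc u w t = \sum_(i < size t) link u w (nth x0 t i) (nth x0 t (ordS i)).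
Proof.
case: t => [|x s] /=; first by rewrite big_ord0.
rewrite walk_sum size_rcons; apply: eq_bigr => i _; congr link.
  by rewrite -rcons_cons nth_rcons /= ltn_ord (set_nth_default x0) //= ltn_ord.
rewrite nth_rcons /=; have := ltn_ord i; rewrite [(i < _.+1)]ltnS leq_eqVlt.
case/orP=> [/eqP->|lt_i]; first by rewrite ltnn eqxx modnn.
by rewrite lt_i modn_small ?ltnS //= (set_nth_default x0).
Qed.

Lemma card_fibres (E S : finType) (f : E -> S) :
  #|{: E}| = \sum_s #|[pred e | f e == s]|.
Proof.
rewrite -sum1_card (partition_big f predT) //=.
by apply: eq_bigr => s _; rewrite sum1_card.
Qed.

(** Equal fibre sizes give Hall's condition for the relation [f1 e1 == f2 e2]. This is how steps of
    words receive actual edges with the right ends. *)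
Lemma bij_over (E1 E2 S : finType) (f1 : E1 -> S) (f2 : E2 -> S) :
    (forall s, #|[pred e | f1 e == s]| = #|[pred e | f2 e == s]|) ->
  exists2 phi : E1 -> E2, bijective phi & forall e, f2 (phi e) = f1 e.
Proof.
move=> eq_fib; have [A|phi inj_phi phiP] := @hall _ _ (fun e1 e2 => f1 e1 == f2 e2).
  have -> : #|nbrs (fun e1 e2 => f1 e1 == f2 e2) A| =
      \sum_(s in f1 @: A) #|[pred e | f2 e == s]|.
    rewrite -sum1_card (partition_big f2 (mem (f1 @: A))) /=; last first.
      by move=> e; rewrite inE => /existsP[e1 /andP[A1 /eqP<-]]; apply: imset_f.
    apply: eq_bigr => s /imsetP[e1 Ae1 ->]; rewrite sum1_card; apply: eq_card => e.
    rewrite unfold_in [RHS]inE; case: eqP => [eq_f|_]; last by rewrite andbF.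
    by rewrite andbT inE; apply/existsP; exists e1; rewrite Ae1 eq_f eqxx.
  under eq_bigr => s _ do rewrite -eq_fib.
  rewrite -sum1_card (partition_big f1 (mem (f1 @: A))) /=; last first.
    by move=> e; apply: imset_f.
  apply: leq_sum => s _; rewrite sum1_card; apply/subset_leq_card/subsetP=> e.
  by rewrite !inE => /andP[].
exists phi => [|e]; last by rewrite (eqP (phiP e)).
apply: inj_card_bij => //; rewrite (card_fibres f1) (card_fibres f2).
by rewrite leq_eqVlt; apply/orP/or_introl/eqP/eq_bigr.
Qed.

Lemma ordS_neq n (i : 'I_n) : 1 < n -> ordS i != i.
Proof.
move=> n_gt1; rewrite -val_eqE /=; have := ltn_ord i; rewrite leq_eqVlt.
by case/orP=> [/eqP i_n | lt_i]; [rewrite i_n modnn; lia | rewrite modn_small; lia].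
Qed.

Lemma decomposable_from_cycles (G : multigraph) N n
    (v : 'I_N -> 'I_n -> vertex G) (phi : 'I_N * 'I_n -> edge G) :
    1 < n -> (forall j, bijective (v j)) -> bijective phi ->
    (forall j i, ends (phi (j, i)) = [set v j i; v j (ordS i)]) ->
  hamiltonian_decomposable G.
Proof.
move=> n_gt1 bij_v [psi phiK psiK] endsE.
exists (preim_partition (fun e => (psi e).1) setT); split; first exact: preim_partitionP.
move=> C /imsetP[e0 _ ->]; set j := (psi e0).1.
exists n, (v j), (fun i => phi (j, i)); split=> //.
  by move=> i i' /(can_inj phiK)[].
apply/setP=> e; rewrite !inE; apply/eqP/imsetP=> [def_j | [i _ ->]]; last by rewrite phiK.
by exists (psi e).2; rewrite // def_j -surjective_pairing psiK.
Qed.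

(** * Multiplicities in [K] and sufficiency *)

Lemma card_part p (a : 'I_p -> nat) i : #|[pred u : Kvertex a | tag u == i]| = a i.
Proof.
rewrite -sum1_card; under eq_bigl => e do rewrite inE -[_ == _]andbT.
rewrite -(sig_big_dep (pred1 i) (fun=> xpredT) (fun _ _ => 1)) /=.
by rewrite big_pred1_eq sum1_card card_ord.
Qed.

Section KEdges.

Variables (p : nat) (a : 'I_p -> nat) (l1 l2 : nat).
Notation V := (Kvertex a).
Notation E := (Kedge a l1 l2).

Lemma Kmult_set2 (u w : V) : Kmult l1 l2 [set u; w] = if tag u == tag w then l1 else l2.
Proof.
rewrite /Kmult; congr (if _ then _ else _); apply/forall_inP/idP.
  by move=> /(_ u (set21 _ _))/forall_inP/(_ w (set22 _ _)).
by move=> /eqP uw x /set2P[]-> ; apply/forall_inP=> y /set2P[]->; rewrite ?uw.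
Qed.

Lemma card_Kends_eq (u w : V) : u != w ->
  #|[pred e : E | Kends e == [set u; w]]| = if tag u == tag w then l1 else l2.
Proof.
move=> uNw; have c2 : #|[set u; w]| == 2 by rewrite cards2 uNw.
pose s0 : {s : {set V} | #|s| == 2} := exist _ [set u; w] c2.
rewrite -Kmult_set2 -sum1_card -[RHS]card_ord.
under eq_bigl => e do rewrite inE -[_ == _]/(tag e == s0) -[_ == s0]andbT.
rewrite -(sig_big_dep (pred1 s0) (fun=> xpredT) (fun _ _ => 1)) /=.
by rewrite big_pred1_eq sum1_card.
Qed.

Lemma decomposable_from_words N (t : 'I_N -> seq V) : 1 < #|{: V}| ->
    balanced (fun u w : V => if tag u == tag w then l1 else l2) (fun=> 1) t ->
  hamiltonian_decomposable (K a l1 l2).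
Proof.
move=> n_gt1 [cnt_t cyc_t].
have uniq_t j : uniq (t j).
  apply: count_mem_uniq => x; rewrite cnt_t.
  by rewrite -has_pred1 has_count cnt_t.
have size_t j : size (t j) = #|V|.
  rewrite -(card_uniqP (uniq_t j)); apply: eq_card => x.
  by rewrite -has_pred1 has_count cnt_t.
have /card_gt0P[x0 _] : 0 < #|{: V}| by apply: ltnW.
pose v j (i : 'I_#|V|) := nth x0 (t j) i.
have inj_v j : injective (v j).
  by move=> i i' /eqP; rewrite nth_uniq ?size_t // => /eqP/val_inj.
pose f1 (q : 'I_N * 'I_#|V|) := [set v q.1 q.2; v q.1 (ordS q.2)].
have [s|phi bij_phi phiP] := @bij_over _ E _ f1 (@Kends _ a l1 l2).
  (* Over a set that is not a pair both fibres are empty; over a pair [balanced] makes both equal to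
     the edge multiplicity. *)
  have [c2 | Nc2] := boolP (#|s| == 2); last first.
    rewrite !eq_card0 // => [e | [j i]]; rewrite !inE; apply: contraNF Nc2 => /eqP <-.
      by rewrite card_Kends.
    by rewrite /f1 cards2 (inj_eq (@inj_v _)) [i == _]eq_sym ordS_neq.
  have /cards2P[u [w [uNw ->]]] := c2.
  rewrite (card_Kends_eq uNw); have := cyc_t u w; rewrite (negPf uNw) !muln1 => <-.
  rewrite -sum1_card big_mkcond /=.
  rewrite -(pair_bigA _ (fun j i => if f1 (j, i) == [set u; w] then 1 else 0)) /=.
  apply: eq_bigr => j _; rewrite (cyc_sum u w x0) size_t; apply: eq_bigr => i _.
  by rewrite -eq_set2 // /f1 /v; case: eqP.
apply: (@decomposable_from_cycles (K a l1 l2) N #|V| v phi) => //.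
- by move=> j; apply: inj_card_bij => //; rewrite card_ord.
- by move=> j i; apply: phiP.
Qed.

End KEdges.

Lemma sufficiency p (a : 'I_p -> nat) l1 l2 m : 1 < p -> 1 < m ->
    (forall i, a i = m) -> ~~ odd (l1 * (m - 1) + l2 * m * (p - 1)) ->
    l1 <= l2 * m * (p - 1) ->
  hamiltonian_decomposable (K a l1 l2).
Proof.
move=> p_gt1 m_gt1 am deg_even l1_le.
have degE : l1 * (m - 1) + l2 * m * (p - 1) = 2 * (l1 * (m - 1) + l2 * m * (p - 1))./2.
  by rewrite mul2n even_halfK.
have card_m i : #|[pred u : Kvertex a | tag u == i]| = m by rewrite card_part.
have [||t bal_t] := multipartite_words card_m _ _ degE l1_le; try exact: ltnW.
apply: decomposable_from_words bal_t.
rewrite (card_fibres (fun u : Kvertex a => tag u)).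
under eq_bigr => i _ do rewrite card_m.
by rewrite sum_nat_const card_ord; nia.
Qed.

(** * Hamiltonian cycles, degrees and necessity *)

Lemma iter_ordS n k (i : 'I_n) : iter k (@ordS n) i = (i + k) %% n :> nat.
Proof.
elim: k => [|k IHk]; first by rewrite addn0 modn_small.
by rewrite iterS /= IHk -addn1 modnDml addn1 addnS.
Qed.

Lemma ordS_closed n (A : {set 'I_n}) :
  (forall i, i \in A -> ordS i \in A) -> A != set0 -> A = setT.
Proof.
move=> clA /set0Pn[i Ai]; apply/setP=> j; rewrite inE.
have Ak k : iter k (@ordS n) i \in A by elim: k => //= k /clA.
(* From [i], [n - i] steps lead to 0 and [j] more to [j]. *)
suff -> : j = iter (n - i + j) (@ordS n) i by apply: Ak.
apply: val_inj; rewrite [RHS]iter_ordS addnA subnKC; last exact: ltnW (ltn_ord i).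
by rewrite modnDl modn_small ?ltn_ord.
Qed.

Section Cycles.

Variables (G : multigraph) (C : {set edge G}).
Hypothesis hamC : hamiltonian_cycle C.

(** The vertex at position [i] lies on the edges indexed by [i] and its predecessor, which differ
    since [1 < n]. *)
Lemma hamiltonian_degree u : #|[set e in C | u \in ends e]| = 2.
Proof.
have [n [v [e [n_gt1 bij_v inj_e -> endsE]]]] := hamC.
have [v' v'K vK] := bij_v.
have -> : [set x in [set e i | i : 'I_n] | u \in ends x] =
    e @: [set v' u; ord_pred (v' u)].
  apply/setP=> x; rewrite inE; apply/andP/imsetP=> [[/imsetP[i _ ->]] | [i]].
    rewrite endsE => /set2P[]->; [exists i | exists i] => //; rewrite v'K ?set21 //.
    by rewrite ordSK set22.
  case/set2P=> -> ->; rewrite imset_f // endsE; split=> //; rewrite ?ord_predK vK ?set21 ?set22 //.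
rewrite card_imset // cards2; congr (_.+1); apply/eqP; rewrite eqb1.
by rewrite -[v' u in X in X != _]ord_predK ordS_neq.
Qed.

(** The edges inside [A] are indexed by the positions in [A] whose successor is also in [A]. If
    these were all positions in [A], then [A] would be closed under succession, hence everything. *)
Lemma hamiltonian_inside (A : {set vertex G}) : A != set0 -> A != setT ->
  #|[set e in C | ends e \subset A]| < #|A|.
Proof.
move=> A0 AT; have [n [v [e [n_gt1 bij_v inj_e -> endsE]]]] := hamC.
pose B := v @^-1: A.
have cardB : #|B| = #|A| by rewrite on_card_preimset //; apply: onW_bij.
have -> : [set x in [set e i | i : 'I_n] | ends x \subset A] =
    e @: (B :&: (@ordS n) @^-1: B).
  apply/setP=> x; rewrite inE; apply/andP/imsetP=> [[/imsetP[i _ ->]] | [i]].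
    by rewrite endsE subUset !sub1set => BB; exists i; rewrite ?inE.
  by rewrite !inE => BB ->; rewrite imset_f // endsE subUset !sub1set.
rewrite card_imset // -cardB; apply: proper_card.
rewrite properE subsetIl subsetI subxx /=; apply: contra AT => /subsetP clB.
have : B = setT.
  apply: ordS_closed => [i /clB|]; first by rewrite inE.
  by rewrite -card_gt0 cardB card_gt0.
move=> BT; apply/eqP/setP=> w; rewrite inE.
have [v' _ vK] := bij_v; have : v' w \in B by rewrite BT inE.
by rewrite inE vK.
Qed.

End Cycles.

Lemma card_partition_cond (T : finType) (P : {set {set T}}) (D : pred T) :
  partition P [set: T] -> #|[set e | D e]| = \sum_(C in P) #|[set e in C | D e]|.
Proof.
have cardE (C : {set T}) : #|[set e in C | D e]| = \sum_(e in C) (D e : nat).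
  by rewrite -sum1dep_card big_mkcondr; apply: eq_bigr => e _; case: (D e).
move=> partP; rewrite (eq_bigr _ (fun C _ => cardE C)) -(set_partition_big _ partP).
by rewrite -cardE; apply: eq_card => e; rewrite !inE.
Qed.

Section Degrees.

Variables (p : nat) (a : 'I_p -> nat) (l1 l2 : nat).
Notation V := (Kvertex a).
Notation E := (Kedge a l1 l2).
Notation mult u w := (if tag (u : V) == tag (w : V) then l1 else l2).

Lemma incident_sum (D : {set V}) (u : V) (e : E) : u \in D -> u \in Kends e ->
  (Kends e \subset D : nat) = \sum_(w | (w \in D) && (w != u)) (Kends e == [set u; w]).
Proof.
move=> Du ue; have /eqP/cards2P[x [y [xNy def_e]]] := card_Kends e.
have [w uNw {def_e}->] : exists2 w, u != w & Kends e = [set u; w].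
  move: ue; rewrite def_e => /set2P[]->; [exists y | exists x] => //.
    by rewrite eq_sym.
  by rewrite setUC.
have eqw w' : ([set u; w] == [set u; w']) = (w' == w).
  apply/eqP/eqP=> [eq_uw | -> //]; have : w \in [set u; w'] by rewrite -eq_uw set22.
  by case/set2P=> // eq_wu; rewrite eq_wu eqxx in uNw.
under eq_bigr => w' _ do rewrite eqw.
rewrite (sum_pred1 (fun w' => (w' \in D) && (w' != u))) eq_sym uNw andbT.
by rewrite subUset !sub1set Du.
Qed.

(** Each edge at [u] is charged to its other end. Taking [D] to be everything gives the degree, and
    taking it to be a part gives the degree inside that part. *)
Lemma card_incident_inside (D : {set V}) (u : V) : u \in D ->
  #|[set e : E | (u \in Kends e) && (Kends e \subset D)]| =
    \sum_(w | (w \in D) && (w != u)) mult u w.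
Proof.
move=> Du; rewrite -sum1dep_card.
transitivity (\sum_(e : E) \sum_(w | (w \in D) && (w != u)) (Kends e == [set u; w])).
  rewrite big_mkcond; apply: eq_bigr => e _.
  have [ue|uNe] := boolP (u \in Kends e).
    by rewrite -incident_sum //; case: (_ \subset _).
  rewrite big1 // => w _; case: eqP => // def_e.
  by rewrite def_e set21 in uNe.
rewrite exchange_big; apply: eq_bigr => w /andP[_ wNu].
rewrite -card_Kends_eq; last by rewrite eq_sym.
by rewrite -sum1_card big_mkcond [RHS]big_mkcond; apply: eq_bigr => e _; rewrite inE; case: eqP.
Qed.

Lemma card_part_rem (u : V) : #|[pred w : V | (tag w == tag u) && (w != u)]| = a (tag u) - 1.
Proof.
rewrite -card_part (cardD1 u [pred w : V | tag w == tag u]) inE eqxx addKn.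
by apply: eq_card => w; rewrite !inE andbC.
Qed.

Lemma degreeK (u : V) :
  #|[set e : E | u \in Kends e]| = l1 * (a (tag u) - 1) + l2 * (#|{: V}| - a (tag u)).
Proof.
have -> : [set e : E | u \in Kends e] =
    [set e : E | (u \in Kends e) && (Kends e \subset [set: V])].
  by apply/setP=> e; rewrite !inE subsetT andbT.
rewrite card_incident_inside ?inE // (bigID (fun w => tag w == tag u)) /=; congr (_ + _).
  rewrite (eq_bigr (fun=> l1)) => [|w /andP[_]]; last by rewrite eq_sym => ->.
  rewrite sum_nat_const mulnC -card_part_rem; congr (_ * _).
  by apply: eq_card => w; rewrite unfold_in !inE andbC.
rewrite (eq_bigr (fun=> l2)) => [|w /andP[_ /negPf]]; last by rewrite eq_sym => ->.
rewrite sum_nat_const mulnC -card_part; congr (_ * _).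
rewrite -(cardC [pred w : V | tag w == tag u]) addKn; apply: eq_card => w.
by rewrite unfold_in !inE; case: (eqVneq w u) => //= ->; rewrite eqxx.
Qed.

(** Handshake count: the degrees inside the part add up to twice its number of edges. *)
Lemma card_inside_part i :
  2 * #|[set e : E | Kends e \subset [set u : V | tag u == i]]| = l1 * (a i * (a i - 1)).
Proof.
set A := [set u : V | _].
have -> : l1 * (a i * (a i - 1)) =
    \sum_(u in A) #|[set e : E | (u \in Kends e) && (Kends e \subset A)]|.
  transitivity (\sum_(u in A) l1 * (a i - 1)).
    rewrite sum_nat_const mulnCA; congr (_ * _); rewrite -card_part.
    by apply: eq_card => u; rewrite !inE.
  apply: eq_bigr => u uA; have ui : tag u = i by apply/eqP; rewrite inE in uA.
  rewrite card_incident_inside //.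
  rewrite (eq_bigr (fun=> l1)) => [|w /andP[]]; last first.
    by rewrite inE ui => /eqP->; rewrite eqxx.
  rewrite sum_nat_const mulnC -ui -card_part_rem; congr (_ * _).
  by apply: eq_card => w; rewrite !inE unfold_in inE ui.
under eq_bigr => u _ do rewrite -sum1dep_card.
rewrite (exchange_big_dep (fun e : E => Kends e \subset A)) /=; last by move=> u e _ /andP[].
rewrite mulnC -sum1dep_card big_distrl; apply: eq_bigr => e eA.
rewrite sum1dep_card -[LHS]/2 -(card_Kends e); apply: eq_card => u.
by rewrite [RHS]in_set eA andbT; apply/idP/andP=> [ue | [] //]; rewrite (subsetP eA).
Qed.

Lemma necessity : hamiltonian_decomposable (K a l1 l2) -> 1 < p -> l1 <> l2 ->
    (forall i, 1 <= a i) -> (exists i, 1 < a i) ->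
  exists m, [/\ forall i, a i = m, ~~ odd (l1 * (m - 1) + l2 * m * (p - 1))
    & l1 <= l2 * m * (p - 1)].
Proof.
move=> [P [partP hamP]] p_gt1 neq_l a_gt0 [i0 ai0].
have deg (u : V) : l1 * (a (tag u) - 1) + l2 * (#|{: V}| - a (tag u)) = 2 * #|P|.
  rewrite -degreeK (card_partition_cond (fun e : E => u \in Kends e) partP).
  rewrite (eq_bigr (fun=> 2)) => [|C PC]; last exact: (hamiltonian_degree (hamP C PC) u).
  by rewrite sum_nat_const mulnC.
have degi i : l1 * (a i - 1) + l2 * (#|{: V}| - a i) = 2 * #|P|.
  exact: (deg (Tagged (fun i => 'I_(a i)) (Ordinal (a_gt0 i)))).
have le_a i : a i <= #|{: V}| by rewrite -card_part max_card.
(* Equal degrees make [(l1 - l2) * a i] constant in [i], and [l1 <> l2]. *)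
have aE i : a i = a i0.
  have := degi i; rewrite -(degi i0); have := le_a i; have := le_a i0.
  by have := a_gt0 i; have := a_gt0 i0; nia.
have cardV : #|{: V}| = p * a i0.
  rewrite (card_fibres (fun u : V => tag u)).
  under eq_bigr => i _ do rewrite card_part aE.
  by rewrite sum_nat_const card_ord.
have degE : l1 * (a i0 - 1) + l2 * a i0 * (p - 1) = 2 * #|P|.
  by rewrite -(degi i0) cardV -mulnA; congr (_ + _ * _); rewrite mulnBr muln1 [p * _]mulnC.
exists (a i0); split=> //; first by rewrite degE oddM.
pose A := [set u : V | tag u == i0].
have cardA : #|A| = a i0 by rewrite -card_part; apply: eq_card => u; rewrite !inE.
have : #|[set e : E | Kends e \subset A]| <= #|P| * (a i0 - 1).
  rewrite (card_partition_cond (fun e : E => Kends e \subset A) partP) -sum_nat_const.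
  apply: leq_sum => C PC.
  have : #|[set e in C | Kends e \subset A]| < #|A|.
    apply: (hamiltonian_inside (hamP C PC)).
      by rewrite -card_gt0 cardA ltnW.
    by apply/eqP=> AT; have := cardsT V; rewrite -AT cardA cardV; nia.
  by rewrite cardA; lia.
(* With [m = a i0], the bound gives [l1 * m * (m - 1) <= 2 * #|P| * (m - 1)]; cancelling [m - 1 > 0]
   and inserting [degE] yields (iii). *)
by have := card_inside_part i0; rewrite -/A; nia.
Qed.

End Degrees.

Theorem theorem5 (p l1 l2 : nat) (a : 'I_p -> nat)
  (hp : 1 < p) (hl2 : 1 <= l2) (hl : l1 <> l2)
  (ha_pos : forall i : 'I_p, 0 < a i)
  (ha_mono : forall i j : 'I_p, i <= j -> a i <= a j)
  (ha_last : forall i : 'I_p, i = p - 1 :> nat -> 2 <= a i) :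
  hamiltonian_decomposable (K a l1 l2) <->
  exists m : nat,
    [/\ forall i : 'I_p, a i = m,
        ~~ odd (l1 * (m - 1) + l2 * m * (p - 1))
      & l1 <= l2 * m * (p - 1)].
Proof.
have lt_last : p - 1 < p by lia.
pose last_part := Ordinal lt_last; have a_last : 1 < a last_part by apply: ha_last.
split=> [decK | [m [am deg_even l1_le]]].
  by apply: necessity decK _ _ _ _ => //; exists last_part.
by apply: (sufficiency hp _ am deg_even l1_le); rewrite -(am last_part).
Qed.
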